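(* Let $W\in\mathbb{R}^{d_L\times d_0}$, let $S$ be a stratum in the rank stratification of the fiber $\mu^{-1}(W)$, and let $\theta=(W_L,W_{L-1},\ldots,W_1)\in S$. Then the tangent space of $S$ at $\theta$ is $$T_\theta S=\Bigl\{(Y_L,Y_{L-1},\ldots,Y_1): Y_j=\Delta W_j+W_jH_{j-1}-H_jW_j\ (1\le j\le L)\Bigr\},$$ where $H_0=0$ and $H_L=0$, the matrices $H_j\in\mathbb{R}^{d_j\times d_j}$ ($1\le j\le L-1$) range over all such matrices, and each $\Delta W_j$ ranges independently over $$\sum_{h=1}^{j-1}\operatorname{col}W_{j\sim h}\otimes\operatorname{null}W_{j-1\sim h-1}^\top+(\operatorname{null}W_{L\sim j}\cap\operatorname{col}W_{j\sim0})\otimes\mathbb{R}^{d_{j-1}}+\sum_{l=j}^{L-1}\operatorname{null}W_{l+1\sim j}\otimes\operatorname{row}W_{l\sim j-1}+\mathbb{R}^{d_j}\otimes(\operatorname{row}W_{L\sim j-1}\cap\operatorname{null}W_{j-1\sim0}^\top).$$ The normal space of $S$ at $\theta$ is $$N_\theta S=\bigl\{(X^{L0}_L,\ldots,X^{L0}_1):M^{L0}\in\mathbb{R}^{d_L\times d_0}\bigr\}+\sum_{L\ge y>x\ge0}\bigl\{(X^{yx}_L,\ldots,X^{yx}_1):M^{yx}\in\operatorname{null}W_{y\sim x}^\top\otimes\operatorname{null}W_{y\sim x}\bigr\},$$ where $$X^{yx}_j=\begin{cases}W_{y\sim j}^\top M^{yx}W_{j-1\sim x}^\top,&j\in[x+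1,y],\\0,&j\notin[x+1,y].\end{cases}$$
   Context: Fix integers $L\ge1$ and $d_0,\ldots,d_L\ge1$. The weight space is $\mathbb{R}^{d_\theta}=\mathbb{R}^{d_L\times d_{L-1}}\times\cdots\times\mathbb{R}^{d_1\times d_0}$ with the Euclidean inner product; a weight vector is $\theta=(W_L,\ldots,W_1)$ with $W_j\in\mathbb{R}^{d_j\times d_{j-1}}$. $\mu(\theta)=W_LW_{L-1}\cdots W_1$, $\mu^{-1}(W)=\{\theta:\mu(\theta)=W\}$. For $L\ge k\ge i\ge0$, $W_{k\sim i}=W_kW_{k-1}\cdots W_{i+1}$, with $W_{k\sim k}=I_{d_k\times d_k}$ (so $\operatorname{null}W_{L\sim L}=\{\mathbf 0\}$ and $\operatorname{null}W_{0\sim0}^\top=\{\mathbf 0\}$). The rank list of $\theta$ is $\langle\operatorname{rk}W_{k\sim i}\rangle_{L\ge k\ge i\ge0}$; the strata of the rank stratification of $\mu^{-1}(W)$ are the nonempty sets of all points of $\mu^{-1}(W)$ having a given rank list. Each stratum is a $C^\infty$ embedded manifold. $T_\theta S$ is the tangent space of $S$ at $\theta$ as a linear subspace of $\mathbb{R}^{d_\theta}$; $N_\theta S=(T_\theta S)^\perp$. For $U\subseteq\mathbb{R}^p$, $V\subseteq\mathbb{R}^q$, $U\otimes V=\{M\in\mathbb{R}^{p\times q}:\operatorname{col}M\subseteq U,\ \operatorname{row}M\subseteq V\}$. Sums of subspaces are vector sums; empty sums are $\{0\}$. *)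

(* Defs.v *)
From HB Require Import structures.
From mathcomp Require Import all_boot all_order all_algebra.
From mathcomp Require Import all_classical all_reals all_analysis.

Set Implicit Arguments.
Unset Strict Implicit.
Unset Printing Implicit Defensive.

Import Order.TTheory GRing.Theory Num.Theory.
Import numFieldNormedType.Exports.

Local Open Scope classical_set_scope.
Local Open Scope ring_scope.

(* Minkowski sum of two subsets of an additive group; iterated with \big, so
   that the empty sum is [set 0]. *)
Definition addset (V : zmodType) (A B : set V) : set V :=
  [set a + b | a in A & b in B].

Notation "\sumset_ ( m <= i < n ) F" := (\big[@addset _/[set 0]]_(m <= i < n) F)
  (at level 41, F at level 41, i, m, n at level 50) : classical_set_scope.

(* Subspaces of R^n are encoded as in mxalgebra: a matrix stands for the span of
   its rows. Row vectors being the transposes of column vectors, the row space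
   of A is A itself and R^n is 1%:M. *)
Section Subspaces.
Variable F : fieldType.

Definition colspace m n (A : 'M[F]_(m, n)) : 'M[F]_(n, m) := A^T.
Definition rowspace m n (A : 'M[F]_(m, n)) : 'M[F]_(m, n) := A.
(* {v | A v = 0}: kermx is the left kernel, whence the transpose *)
Definition nullspace m n (A : 'M[F]_(m, n)) : 'M[F]_n := kermx A^T.

Definition tensor p q u v (U : 'M[F]_(u, p)) (V : 'M[F]_(v, q)) :
    set 'M[F]_(p, q) :=
  [set M | (colspace M <= U)%MS /\ (rowspace M <= V)%MS].

Lemma nullspaceP m n (A : 'M[F]_(m, n)) (v : 'cV[F]_n) :
  (v^T <= nullspace A)%MS <-> A *m v = 0.
Proof.
split=> [/sub_kermxP /(congr1 trmx)|Av0]; first by rewrite trmx_mul !trmxK trmx0.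
by apply/sub_kermxP; rewrite -trmx_mul Av0 trmx0.
Qed.

End Subspaces.

(* theta : weights R L d is (W_L, ..., W_1), with W_j = theta (j - 1); only
   d 0, ..., d L matter. *)
Definition weights (R : realType) (L : nat) (d : nat -> nat) : Type :=
  forall j : 'I_L, 'M[R]_(d j.+1, d j).

Section WeightsZmodule.
Variables (R : realType) (L : nat) (d : nat -> nat).
Local Notation V := (weights R L d).

HB.instance Definition _ := gen_eqMixin V.
HB.instance Definition _ := gen_choiceMixin V.

Let add (x y : V) : V := fun j => x j + y j.
Let opp (x : V) : V := fun j => - x j.
Let zero : V := fun j => 0.

Let addA : associative add.
Proof. by move=> x y z; apply: functional_extensionality_dep => j; exact: addrA. Qed.
Let addC : commutative add.
Proof. by move=> x y; apply: functional_extensionality_dep => j; exact: addrC. Qed.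
Let add0 : left_id zero add.
Proof. by move=> x; apply: functional_extensionality_dep => j; exact: add0r. Qed.
Let addN : left_inverse zero opp add.
Proof. by move=> x; apply: functional_extensionality_dep => j; exact: addNr. Qed.

HB.instance Definition _ := GRing.isZmodule.Build V addA addC add0 addN.

End WeightsZmodule.

Section Network.
Variables (R : realType) (L : nat) (d : nat -> nat).
Local Notation weights := (weights R L d).
Implicit Types (theta : weights) (S : set weights).

Definition wdot (X Y : weights) : R :=
  \sum_(j < L) \sum_(a < d j.+1) \sum_(b < d j) X j a b * Y j a b.

(* W_j for 1 <= j <= L, and the junk value 0 for other j *)
Definition layer theta (j : nat) : 'M[R]_(d j, d j.-1) :=
  match j with
  | 0 => 0
  | j'.+1 => match @idP (j' < L)%N with
             | ReflectT jL => theta (Ordinal jL)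
             | ReflectF _ => 0
             end
  end.

(* W_{k~i} = W_k W_{k-1} ... W_{i+1} for i <= k; the result type depends on
   both k and i, so the identity matrix W_{k~k} is written as pid_mx. Only
   values with i <= k <= L are meaningful. *)
Fixpoint subprod theta (k i : nat) : 'M[R]_(d k, d i) :=
  match k with
  | 0 => pid_mx (d i)
  | k'.+1 => if (i <= k')%N then layer theta k'.+1 *m subprod theta k' i
             else pid_mx (d i)
  end.

Lemma layerE theta (j : 'I_L) : layer theta j.+1 = theta j.
Proof.
case: j => j jL; rewrite /layer; case: {-}_ / idP => // jL'.
by rewrite (bool_irrelevance jL' jL).
Qed.

Lemma subprod_id theta k : subprod theta k k = 1%:M.
Proof. by case: k => [|k] /=; rewrite ?ltnn pid_mx_1. Qed.

Lemma subprodS theta k i : (i <= k)%N ->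
  subprod theta k.+1 i = layer theta k.+1 *m subprod theta k i.
Proof. by move=> /= ->. Qed.

Definition mu theta : 'M[R]_(d L, d 0%N) := subprod theta L 0%N.

Definition is_stratum (W : 'M[R]_(d L, d 0%N)) S : Prop :=
  S !=set0 /\
  exists r : nat -> nat -> nat,
    S = [set theta | mu theta = W /\
          forall k i, (i <= k <= L)%N -> \rank (subprod theta k i) = r k i].

Definition smooth_near0 (f : R -> R) : Prop :=
  exists2 e : R, 0 < e &
    forall (n : nat) (t : R), `|t| < e -> derivable (f^`(n))%classic t 1.

(* Tangent space at theta of an embedded C^oo submanifold S of the weight space:
   the velocities at time 0 of the C^oo curves in S that pass through theta at
   time 0. Smoothness and velocity are taken coordinatewise. *)
Definition tangent_subspace S theta : set weights :=
  [set Y | exists c : R -> weights,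
     [/\ c 0 = theta,
         \forall t \near (0 : R), S (c t),
         forall j a b, smooth_near0 (fun t => c t j a b) &
         forall j a b, is_derive (0 : R) (1 : R) (fun t => c t j a b) (Y j a b)]].

Definition normal_subspace S theta : set weights :=
  [set X | forall Y, tangent_subspace S theta Y -> wdot X Y = 0].

(* the subspace in which Delta W_j ranges, 1 <= j <= L *)
Definition delta_space theta (j : nat) : set 'M[R]_(d j, d j.-1) :=
  let W := subprod theta in
  addset (addset (addset
    (\sumset_(1 <= h < j) tensor (colspace (W j h)) (nullspace (W j.-1 h.-1)^T))
    (tensor (nullspace (W L j) :&: colspace (W j 0%N))%MS (1%:M : 'M[R]_(d j.-1))))
    (\sumset_(j <= l < L) tensor (nullspace (W l.+1 j)) (rowspace (W l j.-1))))
    (tensor (1%:M : 'M[R]_(d j))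
            (rowspace (W L j.-1) :&: nullspace (W j.-1 0%N)^T)%MS).

Definition Xmx theta (y x : nat) (M : 'M[R]_(d y, d x)) (j : nat) :
    'M[R]_(d j, d j.-1) :=
  if (x.+1 <= j <= y)%N
  then (subprod theta y j)^T *m M *m (subprod theta j.-1 x)^T else 0.

(* (X^{yx}_L, ..., X^{yx}_1) *)
Definition Xvec theta (y x : nat) (M : 'M[R]_(d y, d x)) : weights :=
  fun j : 'I_L => Xmx theta M j.+1.

End Network.

Arguments delta_space {R L d} theta j _.

(* Main.v *)
Require Import Defs.
From mathcomp Require Import all_boot all_order all_fingroup all_algebra.
From mathcomp Require Import all_classical all_reals all_analysis.
From mathcomp Require Import ring.
Import Order.TTheory GRing.Theory Num.Theory.
Local Open Scope classical_set_scope.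
Local Open Scope ring_scope.

Set Implicit Arguments.
Unset Strict Implicit.
Unset Printing Implicit Defensive.
Import numFieldNormedType.Exports.

(* Let B be the space of all Y whose derivative D_{y~x} of W_{y~x} maps
   null W_{y~x} into col W_{y~x} for all y >= x, with moreover D_{L~0} = 0. Let A
   be the space of the Y_j = G_j W_j - W_j G_{j-1} with G_L W = W G_0. Both the
   tangent space T and its claimed parametrization T' are squeezed between them.
   - T is included in B: bordered minors of W_{y~x} vanish along a curve in S.
   - B is included in A: by induction on the layers, Y_1, ..., Y_m may be assumed
     to vanish. The remaining conditions on Y_{m+1} say that it respects the
     filtrations by the images of the W_{m~x} on null W_{m+1}. Sections of the
     W_j compatible with these filtrations then provide G_{m+1}, G_m, ..., G_0.
   - A is included in T: use the curve (1 + t G_j) W_j (1 + t G_{j-1})^-1.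
   - A is included in T': change G by an endomorphism of the chain so that
     G_L W = 0 and W G_0 = 0; the end terms are then allowed values of Delta.
   - T' is included in B, one tensor summand of Delta at a time.
   The claimed normal space is a subspace whose orthogonal is B. *)

(** * Matrices and compatible sections *)

Section MatrixLemmas.
Variable F : fieldType.

Lemma col_pinvmx m n k (A : 'M[F]_(m, n)) (B : 'M[F]_(m, k)) (C : 'M[F]_(k, n)) :
  A = B *m C -> B *m pinvmx B *m A = A.
Proof. by move=> ->; rewrite mulmxA mulmxKpV. Qed.

(* D maps null A into col A: this characterizes the velocities at A of the
   curves of matrices of constant rank. *)
Definition rank_tangent m n (A D : 'M[F]_(m, n)) :=
  forall (p : 'rV[F]_m) (q : 'cV[F]_n), p *m A = 0 -> A *m q = 0 -> p *m D *m q = 0.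

Lemma rank_tangent_mx m n a b (A D : 'M[F]_(m, n)) (P : 'M[F]_(a, m))
    (Q : 'M[F]_(n, b)) :
  rank_tangent A D -> P *m A = 0 -> A *m Q = 0 -> P *m D *m Q = 0.
Proof.
move=> AD PA AQ; apply/matrixP => i j.
have := AD (row i P) (col j Q).
rewrite -row_mul PA row0 => /(_ erefl); rewrite colE mulmxA AQ mul0mx => /(_ erefl).
by rewrite mulmxA -!row_mul -colE => /matrixP/(_ 0 0); rewrite !mxE => ->.
Qed.

(** Every row that annihilates [A] also annihilates [D *m Q], by [rank_tangent]; hence the columns
    of [D *m Q] lie in col [A]. *)
Lemma rank_tangent_col m n b (A D : 'M[F]_(m, n)) (Q : 'M[F]_(n, b)) :
  rank_tangent A D -> A *m Q = 0 -> exists U, D *m Q = A *m U.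
Proof.
move=> AD AQ.
have: ((D *m Q)^T <= A^T)%MS.
  rewrite submxE -[cokermx _]trmxK -trmx_mul mulmxA.
  rewrite (rank_tangent_mx AD) ?trmx0 //.
  by apply: trmx_inj; rewrite trmx_mul trmxK mulmx_coker trmx0.
move=> /submxP[U DQ]; exists U^T.
by rewrite -[LHS]trmxK DQ trmx_mul trmxK.
Qed.

Lemma rank_tangent0 m n (A : 'M[F]_(m, n)) : rank_tangent A 0.
Proof. by move=> p q _ _; rewrite mulmx0 mul0mx. Qed.

Lemma rank_tangentD m n (A D E : 'M[F]_(m, n)) :
  rank_tangent A D -> rank_tangent A E -> rank_tangent A (D + E).
Proof.
move=> AD AE p q pA Aq.
by rewrite mulmxDr mulmxDl AD // AE // addr0.
Qed.

Lemma rank_tangentN m n (A D : 'M[F]_(m, n)) :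
  rank_tangent A D -> rank_tangent A (- D).
Proof. by move=> AD p q pA Aq; rewrite mulmxN mulNmx AD // oppr0. Qed.

Lemma rank_tangent_sum m n (A : 'M[F]_(m, n)) I (r : seq I) (P : pred I)
    (D : I -> 'M[F]_(m, n)) :
  (forall i, P i -> rank_tangent A (D i)) ->
  rank_tangent A (\sum_(i <- r | P i) D i).
Proof.
move=> AD; elim/big_ind: _ => //; first exact: rank_tangent0.
exact: rank_tangentD.
Qed.

Lemma rank_tangent_mull m n (A : 'M[F]_(m, n)) (H : 'M[F]_n) :
  rank_tangent A (A *m H).
Proof. by move=> p q pA _; rewrite mulmxA pA !mul0mx. Qed.

Lemma rank_tangent_mulr m n (A : 'M[F]_(m, n)) (G : 'M[F]_m) :
  rank_tangent A (G *m A).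
Proof. by move=> p q _ Aq; rewrite -!mulmxA Aq !mulmx0. Qed.

(** Induction along the filtration: a section compatible with the smaller steps is extended to the
    next one without changing it on col [W *m A n]. *)
Lemma filtered_section p q (a : nat -> nat) (A : forall k, 'M[F]_(p, a k))
    (W : 'M[F]_(q, p)) n :
  (forall x y, (x <= y <= n)%N -> exists C, A x = A y *m C) ->
  exists s : 'M[F]_(p, q), forall x, (x <= n)%N ->
    W *m s *m (W *m A x) = W *m A x /\
    exists C, s *m (W *m A x) = A x *m C.
Proof.
elim: n => [|n IHn] nested.
  exists (A 0%N *m pinvmx (W *m A 0%N)) => x; rewrite leqn0 => /eqP->; split.
    by rewrite (mulmxA W (A 0%N)) (@col_pinvmx _ _ _ _ _ 1%:M) ?mulmx1.
  by exists (pinvmx (W *m A 0%N) *m (W *m A 0%N)); rewrite !mulmxA.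
have [|s sP] := IHn.
  by move=> x y /andP[xy yn]; apply: nested; rewrite xy leqW.
set B := W *m A n; set E := W *m A n.+1.
set P := B *m pinvmx B; set t := A n.+1 *m pinvmx E.
have [C AC] : exists C, A n = A n.+1 *m C by apply: nested; rewrite leqnSn leqnn.
(* [P] projects onto col [B]. The old section is kept there, and the lift [t] through [A n.+1] is
   used on the complement. *)
exists (s *m P + t *m (1%:M - P)) => x.
rewrite leq_eqVlt ltnS => /predU1P[->|xn].
  have BE : B = E *m C by rewrite /B AC mulmxA.
  have tP : W *m t *m (E - P *m E) = E - P *m E.
    rewrite /t (mulmxA W (A n.+1)) -/E.
    rewrite (@col_pinvmx _ _ _ _ _ (1%:M - C *m pinvmx B *m E)) //.
    by rewrite mulmxBr mulmx1 (mulmxA E) (mulmxA E) -BE.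
  have sB : W *m s *m B = B by case: (sP n (leqnn n)).
  have [C' sB'] : exists C', s *m B = A n *m C' by case: (sP n (leqnn n)).
  rewrite -/E; split.
    rewrite mulmxDr mulmxDl (mulmxA W s) (mulmxA W t) -[X in _ + X]mulmxA.
    rewrite mulmxBl mul1mx tP /P -[W *m s *m _ *m E]mulmxA -[B *m _ *m E]mulmxA.
    by rewrite (mulmxA (W *m s)) sB addrC subrK.
  exists (C *m (C' *m pinvmx B *m E) + pinvmx E *m (1%:M - P) *m E).
  rewrite mulmxDl mulmxDr; congr (_ + _); last by rewrite /t !mulmxA.
  by rewrite /P (mulmxA s) sB' {1}AC !mulmxA.
(* For [x <= n], [P] fixes [W *m A x], so the new section agrees there with the old one. *)
have [C' xC'] : exists C', A x = A n *m C' by apply: nested; rewrite xn leqnSn.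
have PA : P *m (W *m A x) = W *m A x.
  by rewrite /P (@col_pinvmx _ _ _ _ _ C') // xC' mulmxA.
have sE : (s *m P + t *m (1%:M - P)) *m (W *m A x) = s *m (W *m A x).
  rewrite mulmxDl -(mulmxA s) -(mulmxA t) PA mulmxBl mul1mx PA.
  by rewrite subrr mulmx0 addr0.
have [WsA sA] := sP x xn.
by split; rewrite -?(mulmxA W (_ + _)) sE // mulmxA.
Qed.

End MatrixLemmas.

(** * First-order deformations of a chain of matrices *)

Section Network.
Variables (R : realType) (L : nat) (d : nat -> nat).
Local Notation weights := (weights R L d).
Implicit Types (theta X Y : weights) (y : forall k, 'M[R]_(d k.+1, d k)).

Lemma subprod_comp theta k j i : (i <= j <= k)%N ->
  subprod theta k i = subprod theta k j *m subprod theta j i.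
Proof.
elim: k => [|k IHk] /andP[ij].
  rewrite leqn0 => /eqP j0; move: ij; rewrite j0 leqn0 => /eqP ->.
  by rewrite subprod_id mulmx1.
rewrite leq_eqVlt ltnS => /predU1P[->|jk]; first by rewrite subprod_id mul1mx.
rewrite !subprodS ?(leq_trans ij) // IHk ?ij //.
by rewrite mulmxA.
Qed.

Lemma subprod1 theta k : subprod theta k.+1 k = layer theta k.+1.
Proof. by rewrite subprodS // subprod_id mulmx1. Qed.

Lemma subprodSr theta k i : (i < k)%N ->
  subprod theta k i = subprod theta k i.+1 *m layer theta i.+1.
Proof. by move=> ik; rewrite -subprod1 -subprod_comp // leqnSn. Qed.

(* The derivative of W_{k~i} in the direction y, where y j perturbs W_{j+1}. *)
Definition dsubprod theta y (k i : nat) : 'M[R]_(d k, d i) :=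
  \sum_(i <= j < k) subprod theta k j.+1 *m y j *m subprod theta j i.

Lemma dsubprodS theta y k i : (i <= k)%N ->
  dsubprod theta y k.+1 i =
    y k *m subprod theta k i + layer theta k.+1 *m dsubprod theta y k i.
Proof.
move=> ik; rewrite /dsubprod big_nat_recr // addrC subprod_id mul1mx.
congr (_ + _); rewrite mulmx_sumr !big_nat; apply: eq_bigr => j /andP[_ jk].
by rewrite subprodS // !mulmxA.
Qed.

Lemma dsubprod_id theta y k : dsubprod theta y k k = 0.
Proof. by rewrite /dsubprod big_geq. Qed.

Lemma eq_dsubprod theta y y' k i :
  (forall j, (i <= j < k)%N -> y j = y' j) ->
  dsubprod theta y k i = dsubprod theta y' k i.
Proof.
by move=> yy'; rewrite /dsubprod !big_nat; apply: eq_bigr => j /yy' ->.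
Qed.

Lemma dsubprodD theta y y' k i :
  dsubprod theta (fun j => y j + y' j) k i =
  dsubprod theta y k i + dsubprod theta y' k i.
Proof.
rewrite /dsubprod -big_split; apply: eq_bigr => j _.
by rewrite mulmxDr mulmxDl.
Qed.

Lemma dsubprodN theta y k i :
  dsubprod theta (fun j => - y j) k i = - dsubprod theta y k i.
Proof.
rewrite /dsubprod -sumrN; apply: eq_bigr => j _.
by rewrite mulmxN mulNmx.
Qed.

(** Velocity at 0 of the base change (1 + t G_{k+1}) W_{k+1} (1 + t G_k)^-1; it vanishes when [G]
    commutes with this layer. *)
Definition gauge theta (G : forall k, 'M[R]_(d k)) k : 'M[R]_(d k.+1, d k) :=
  G k.+1 *m layer theta k.+1 - layer theta k.+1 *m G k.

(** The contributions of the intermediate [G j] telescope, leaving the two ends. *)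
Lemma dsubprod_gauge theta (G : forall k, 'M[R]_(d k)) k i : (i <= k)%N ->
  dsubprod theta (gauge theta G) k i =
  G k *m subprod theta k i - subprod theta k i *m G i.
Proof.
elim: k => [|k IHk].
  by rewrite leqn0 => /eqP->; rewrite dsubprod_id subprod_id mul1mx mulmx1 subrr.
rewrite leq_eqVlt ltnS => /predU1P[->|ik].
  by rewrite dsubprod_id subprod_id mul1mx mulmx1 subrr.
rewrite dsubprodS // IHk // subprodS // mulmxBl mulmxBr !mulmxA.
by rewrite addrA addrNK.
Qed.

Lemma rank_tangent_gauge theta (G : forall k, 'M[R]_(d k)) k i : (i <= k)%N ->
  rank_tangent (subprod theta k i) (dsubprod theta (gauge theta G) k i).
Proof.
move=> ik; rewrite dsubprod_gauge //; apply: rank_tangentD.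
  exact: rank_tangent_mulr.
by apply: rank_tangentN; exact: rank_tangent_mull.
Qed.

(** The output of [filtered_section] for the images of the W_{m~x}. As W_{m~m} is the identity, the
    case [x = m] makes [s] a generalized inverse of the layer. *)
Definition layer_section theta m (s : 'M[R]_(d m, d m.+1)) :=
  forall x, (x <= m)%N ->
    layer theta m.+1 *m s *m subprod theta m.+1 x = subprod theta m.+1 x /\
    exists C, s *m subprod theta m.+1 x = subprod theta m x *m C.

Lemma ex_layer_section theta m : exists s, @layer_section theta m s.
Proof.
have [x y /andP[xy ym]|s sP] :=
  @filtered_section _ _ _ d (fun x => subprod theta m x) (layer theta m.+1) m.
  by exists (subprod theta y x); rewrite -subprod_comp // xy.
by exists s => x xm; have := sP x xm; rewrite -subprodS.
Qed.

(** Descend one layer [l] at a time with [s *m g *m l]: it is intertwined with [g] by [l] because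
    [g] preserves col [l], and it preserves the next filtration because [g] and [s] respect the
    filtrations. *)
Lemma extend_endomorphism theta m (g : 'M[R]_(d m)) :
  (forall x, (x <= m)%N ->
     exists C, g *m subprod theta m x = subprod theta m x *m C) ->
  exists G : forall k, 'M[R]_(d k), G m = g /\
    forall k, (k < m)%N -> gauge theta G k = 0.
Proof.
elim: m g => [|m IHm] g gP.
  (* [dfwith] overrides a family at a single index. *)
  by exists (eqtype.dfwith (fun k => 0 : 'M[R]_(d k)) g); split; rewrite ?dfwith_in.
have [s sP] := ex_layer_section theta m.
set l := layer theta m.+1.
have [C gl] : exists C, g *m l = l *m C.
  by have [C] := gP m (leqnSn m); rewrite subprod1; exists C.
have lsl : l *m s *m l = l by have [] := sP m (leqnn m); rewrite subprod1.
have [x xm|G [Gm GP]] := IHm (s *m g *m l).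
  have [C1 gC1] := gP x (leqW xm); have [_ [C2 sC2]] := sP x xm.
  exists (C2 *m C1).
  by rewrite -!mulmxA -subprodS // gC1 !mulmxA sC2 -!mulmxA.
exists (eqtype.dfwith G g); split; first by rewrite dfwith_in.
move=> k; rewrite ltnS leq_eqVlt => /predU1P[->|km]; rewrite /gauge.
  rewrite dfwith_in dfwith_out ?gtn_eqF // Gm -/l !mulmxA.
  by rewrite -[l *m s *m g *m l]mulmxA gl !mulmxA lsl subrr.
rewrite !dfwith_out ?gtn_eqF //; first exact: GP.
by rewrite ltnS ltnW.
Qed.

(** Once [G0] accounts for the first [m] layers, the remainder [z] lives on one layer. Its part
    [z m *m s *m l] is absorbed by the new value at [m.+1], and the part through [1 - s *m l] by an
    endomorphism of the lower chain. *)
Lemma rank_tangent_is_gauge theta y m :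
  (forall k i, (i <= k <= m)%N ->
     rank_tangent (subprod theta k i) (dsubprod theta y k i)) ->
  exists G, forall k, (k < m)%N -> y k = gauge theta G k.
Proof.
elim: m => [|m IHm] yP; first by exists (fun=> 0).
have [k i /andP[ik km]|G0 G0P] := IHm; first by apply: yP; rewrite ik leqW.
pose z k := y k - gauge theta G0 k.
have zP x : (x <= m)%N ->
    rank_tangent (subprod theta m.+1 x) (z m *m subprod theta m x).
  move=> xm.
  have -> : z m *m subprod theta m x = dsubprod theta z m.+1 x.
    rewrite dsubprodS // [dsubprod _ _ m x]big_nat big1 ?mulmx0 ?addr0 //.
    by move=> j /andP[_ jm]; rewrite /z -G0P // subrr mulmx0 mul0mx.
  rewrite dsubprodD dsubprodN; apply: rank_tangentD.
    by apply: yP; rewrite leqW /=.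
  by apply: rank_tangentN; apply: rank_tangent_gauge; exact: leqW.
have [s sP] := ex_layer_section theta m.
set l := layer theta m.+1 in sP *.
have lsl : l *m s *m l = l by have [] := sP m (leqnn m); rewrite subprod1.
have zker b x (Q : 'M[R]_(d x, b)) : (x <= m)%N -> subprod theta m.+1 x *m Q = 0 ->
    exists U, z m *m subprod theta m x *m Q = subprod theta m.+1 x *m U.
  by move=> xm; apply: rank_tangent_col; exact: zP.
(* g accounts for z m on null W_{m+1}, and z m *m s for the rest. *)
pose g := - (s *m z m *m (1%:M - s *m l)).
have lg : - (l *m g) = z m *m (1%:M - s *m l).
  have [|U] := zker _ m (1%:M - s *m l) (leqnn m).
    by rewrite subprod1 mulmxBr mulmx1 mulmxA lsl subrr.
  rewrite subprod_id mulmx1 subprod1 -/l => zU.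
  by rewrite /g mulmxN opprK -(mulmxA s) zU !mulmxA lsl.
(* On col W_{m~x}, [1 - s *m l] lands in the part of that space killed by [l]; [z m] sends this part
   into col W_{m+1~x}, and [s] brings it back into col W_{m~x}. So [g] preserves the filtration. *)
have [x xm|G [Gm GP]] := @extend_endomorphism theta m g.
  have [sx1 [C sC]] := sP x xm.
  have slA : (1%:M - s *m l) *m subprod theta m x =
             subprod theta m x *m (1%:M - C).
    by rewrite mulmxBl mulmxBr mulmx1 mul1mx -mulmxA -subprodS // sC.
  have [|U zU] := zker _ x (1%:M - C) xm.
    rewrite subprodS // -mulmxA -slA mulmxA mulmxBr mulmx1 -/l.
    by rewrite mulmxA lsl subrr mul0mx.
  exists (- (C *m U)).
  rewrite /g mulNmx -(mulmxA (s *m z m)) slA -(mulmxA s) (mulmxA (z m)) zU.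
  by rewrite (mulmxA s) sC mulmxN mulmxA.
exists (fun k => G0 k + eqtype.dfwith G (z m *m s) k) => k.
rewrite ltnS /gauge => km.
have -> : (G0 k.+1 + eqtype.dfwith G (z m *m s) k.+1) *m layer theta k.+1 -
    layer theta k.+1 *m (G0 k + eqtype.dfwith G (z m *m s) k) =
    gauge theta G0 k + gauge theta (eqtype.dfwith G (z m *m s)) k.
  by rewrite mulmxDl mulmxDr opprD addrACA.
move: km; rewrite leq_eqVlt => /predU1P[->|km]; rewrite [X in _ + X]/gauge.
  rewrite dfwith_in dfwith_out ?gtn_eqF // Gm -/l lg mulmxBr mulmx1 (mulmxA (z m)).
  rewrite [_ + (z m - _)]addrCA subrr addr0.
  by rewrite /z addrC subrK.
rewrite !dfwith_out ?gtn_eqF //; last by rewrite ltnS ltnW.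
by rewrite -/(gauge theta G k) GP // addr0 G0P.
Qed.

End Network.

(** * The parametrization of the tangent space *)

Section SumSets.
Variable V : zmodType.

Lemma sumset0 (r : seq nat) (F : nat -> set V) :
  (forall i, i \in r -> F i 0) -> (\big[@addset _/[set 0]]_(i <- r) F i) 0.
Proof.
move=> F0; rewrite big_seq; elim/big_ind: _ => //=.
by move=> A B A0 B0; exists 0 => //; exists 0 => //; rewrite addr0.
Qed.

Lemma sub_sumset (r : seq nat) (F : nat -> set V) i :
  (forall i, i \in r -> F i 0) -> i \in r ->
  F i `<=` \big[@addset _/[set 0]]_(i <- r) F i.
Proof.
elim: r => // j r IHr F0; rewrite big_cons inE => /predU1P[->|ir] x Fx.
  exists x => //; exists 0; last by rewrite addr0.
  by apply: sumset0 => k kr; apply: F0; rewrite inE kr orbT.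
exists 0; first by apply: F0; rewrite inE eqxx.
exists x; last by rewrite add0r.
by apply: IHr => // k kr; apply: F0; rewrite inE kr orbT.
Qed.

Lemma sumset_min (r : seq nat) (F : nat -> set V) (P : set V) :
  P 0 -> (forall x y, P x -> P y -> P (x + y)) ->
  (forall i, i \in r -> F i `<=` P) ->
  \big[@addset _/[set 0]]_(i <- r) F i `<=` P.
Proof.
move=> P0 PD FP; rewrite big_seq; elim/big_ind: _ => // [x ->//|A B AP BP].
by move=> _ [a /AP Pa [b /BP Pb <-]]; exact: PD.
Qed.

End SumSets.

Section Tensor.
Variable F : fieldType.

Lemma tensor0 p q u v (U : 'M[F]_(u, p)) (V : 'M[F]_(v, q)) : tensor U V 0.
Proof. by split; rewrite /colspace /rowspace ?trmx0 sub0mx. Qed.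

Lemma sub_colspaceP m n k (A : 'M[F]_(m, n)) (D : 'M[F]_(m, k)) :
  reflect (exists K, D = A *m K) (D^T <= colspace A)%MS.
Proof.
apply: (iffP submxP) => -[K DK]; exists K^T; last by rewrite DK trmx_mul.
by apply: trmx_inj; rewrite DK trmx_mul trmxK.
Qed.

Lemma sub_nullspaceP m n k (A : 'M[F]_(m, n)) (D : 'M[F]_(n, k)) :
  reflect (A *m D = 0) (D^T <= nullspace A)%MS.
Proof.
apply: (iffP sub_kermxP) => [DA|DA]; last by rewrite -trmx_mul DA trmx0.
by apply: trmx_inj; rewrite trmx_mul DA trmx0.
Qed.

Lemma sub_nullspace_trP m n k (A : 'M[F]_(n, m)) (D : 'M[F]_(k, n)) :
  reflect (D *m A = 0) (D <= nullspace A^T)%MS.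
Proof. by rewrite /nullspace trmxK; exact: sub_kermxP. Qed.

End Tensor.

Section Tangent.
Variables (R : realType) (L : nat) (d : nat -> nat).
Local Notation weights := (weights R L d).
Implicit Types (theta X Y : weights).

(** Shifted by one and total in [k], as [dsubprod] expects; the value for [k >= L] is 0. *)
Definition layers Y k : 'M[R]_(d k.+1, d k) := layer Y k.+1.

(** The space B: the conditions defining a stratum, differentiated once. *)
Definition linearized_stratum theta : set weights :=
  [set Y | dsubprod theta (layers Y) L 0 = 0 /\
     forall k i, (i <= k <= L)%N ->
       rank_tangent (subprod theta k i) (dsubprod theta (layers Y) k i)].

(** B is included in A: [dsubprod_gauge] turns D_{L~0} = 0 into the condition on the two ends of
    [G]. *)
Lemma linearized_stratum_gauge theta Y : linearized_stratum theta Y ->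
  exists G, G L *m subprod theta L 0 = subprod theta L 0 *m G 0%N /\
    forall j : 'I_L, Y j = gauge theta G j.
Proof.
move=> [Y0 /rank_tangent_is_gauge[G YG]]; exists G; split; last first.
  by move=> j; rewrite -layerE; exact: YG.
apply/eqP; rewrite -subr_eq0 -dsubprod_gauge // -Y0; apply/eqP.
by apply: eq_dsubprod => j /andP[_ jL]; rewrite YG.
Qed.

Definition delta_gauge theta : set weights :=
  [set Y : weights |
      exists (H : forall k : nat, 'M[R]_(d k)) (Delta : weights),
      [/\ H 0%N = 0, H L = 0,
          forall j : 'I_L, delta_space theta j.+1 (Delta j) &
          forall j : 'I_L, Y j = Delta j + theta j *m H j - H j.+1 *m theta j]].

Lemma delta_spaceI theta (j : nat) (A B : 'M[R]_(d j.+1, d j)) :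
  tensor (nullspace (subprod theta L j.+1) :&:
          colspace (subprod theta j.+1 0%N))%MS (1%:M : 'M[R]_(d j)) A ->
  tensor (1%:M : 'M[R]_(d j.+1)) (rowspace (subprod theta L j) :&:
          nullspace (subprod theta j 0%N)^T)%MS B ->
  delta_space theta j.+1 (A + B).
Proof.
move=> tA tB; exists A; last by exists B.
exists A; last first.
  by exists 0; rewrite ?addr0 //; apply: sumset0 => i _; exact: tensor0.
exists 0; last by exists A; rewrite ?add0r.
by apply: sumset0 => i _; exact: tensor0.
Qed.

Lemma gauge_delta theta G Y : (0 < L)%N ->
  G L *m subprod theta L 0 = subprod theta L 0 *m G 0%N ->
  (forall j : 'I_L, Y j = gauge theta G j) -> delta_gauge theta Y.
Proof.
move=> L0; set W := subprod theta L 0 => GW YG.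
(* Subtracting the endomorphism W_{k~0} G_0 s W_{L~k} of the chain, where s is
   a section of W, makes both G_L W and W G_0 vanish. *)
have [s WsW] : exists s, W *m s *m W = W.
  by exists (pinvmx W); rewrite (@col_pinvmx _ _ _ _ _ _ 1%:M) ?mulmx1.
pose G' k := G k - subprod theta k 0 *m (G 0%N *m s) *m subprod theta L k.
have G'0 : W *m G' 0%N = 0.
  rewrite /G' subprod_id mul1mx -/W mulmxBr -GW !mulmxA -GW.
  by rewrite -(mulmxA (G L)) -(mulmxA (G L)) WsW subrr.
have G'L : G' L *m W = 0.
  rewrite /G' subprod_id mulmx1 -/W mulmxBl GW !mulmxA -GW.
  by rewrite -(mulmxA (G L)) -(mulmxA (G L)) WsW subrr.
have YG' (j : 'I_L) : Y j = G' j.+1 *m theta j - theta j *m G' j.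
  rewrite YG /gauge layerE /G' mulmxBl mulmxBr opprB addrA.
  rewrite [subprod theta L j]subprodSr // subprodS // layerE !mulmxA.
  by rewrite subrK.
(* Inside the chain [H] is [- G']. As [H] must vanish at both ends, the terms with G'_0 and G'_L
   move into Delta, as [A] in layer 1 and [B] in layer L; for L = 1 these coincide. *)
pose H k := if (k == 0%N) || (k == L) then 0 else - G' k.
pose A (j : nat) : 'M[R]_(d j.+1, d j) :=
  if j == 0%N then - (layer theta j.+1 *m G' j) else 0.
pose B (j : nat) : 'M[R]_(d j.+1, d j) :=
  if j.+1 == L then G' j.+1 *m layer theta j.+1 else 0.
exists H, (fun j : 'I_L => A j + B j); split.
- by rewrite /H eqxx.
- by rewrite /H eqxx orbT.
- case=> j /= jL; apply: delta_spaceI.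
    rewrite /A; case: eqP => [j0|_]; last exact: tensor0.
    move: jL; rewrite {}j0 => jL; split; last exact: submx1.
    rewrite sub_capmx; apply/andP; split.
      by apply/sub_nullspaceP; rewrite mulmxN mulmxA -subprodSr // G'0 oppr0.
    by apply/sub_colspaceP; exists (- G' 0%N); rewrite subprod1 mulmxN.
  rewrite /B; case: eqP => [jE|_]; last exact: tensor0.
  split; first by rewrite /colspace submx1.
  rewrite sub_capmx; apply/andP; split.
    (* Replacing [L] by a variable [k] allows the equation to be substituted despite the dependent
       types. *)
    suff subk k : k = j.+1 -> (G' j.+1 *m layer theta j.+1 <= subprod theta k j)%MS.
      exact: subk.
    by move=> ->; rewrite subprod1 submxMl.
  apply/sub_nullspace_trP; rewrite -mulmxA -subprodS //.
  suff G'k k : k = L -> G' k *m subprod theta k 0 = 0 by exact: G'k.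
  by move=> ->.
- case=> j jL /=; rewrite YG' /= /A /B /H /= -!(layerE _ (Ordinal jL)) /=.
  case: (eqVneq j 0%N) => [->|_] /=.
    case: (eqVneq 1%N L) => [|_] /=.
      by rewrite mulmx0 mul0mx addr0 subr0 addrC.
    by rewrite mulmx0 addr0 addr0 mulNmx opprK addrC.
  have -> : (j == L) = false by rewrite ltn_eqF.
  case: (eqVneq j.+1 L) => [_|_] /=.
    by rewrite mul0mx subr0 add0r mulmxN.
  by rewrite !addr0 add0r mulNmx opprK mulmxN addrC.
Qed.

(* A summand of the derivative of W_{k~i}, for a perturbation D of layer j+1. *)
Let term theta j (D : 'M[R]_(d j.+1, d j)) k i :=
  subprod theta k j.+1 *m D *m subprod theta j i.

(** As [h <= i], W_{k~h} = W_{k~i} W_{i~h}, so the term is W_{k~i} times a matrix. *)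
Lemma rank_tangent_term_col theta j (D : 'M[R]_(d j.+1, d j)) h K k i :
  D = subprod theta j.+1 h *m K -> (h <= i <= j)%N -> (j < k)%N ->
  rank_tangent (subprod theta k i) (term theta D k i).
Proof.
move=> -> /andP[hi ij] jk; rewrite /term mulmxA -subprod_comp; last first.
  by rewrite jk !(leq_trans hi) // leqW.
rewrite (@subprod_comp _ _ _ _ k i h) ?hi ?(leq_trans ij) 1?ltnW // -!mulmxA.
exact: rank_tangent_mull.
Qed.

(** As [k <= l], W_{l~i} = W_{l~k} W_{k~i}, so the term is a matrix times W_{k~i}. *)
Lemma rank_tangent_term_row theta j (D : 'M[R]_(d j.+1, d j)) l K k i :
  D = K *m subprod theta l j -> (j < k <= l)%N -> (i <= j)%N ->
  rank_tangent (subprod theta k i) (term theta D k i).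
Proof.
move=> -> /andP[jk kl] ij; rewrite /term -!mulmxA -subprod_comp; last first.
  by rewrite ij (leq_trans (ltnW jk)).
rewrite (@subprod_comp _ _ _ _ l k i) ?kl ?(leq_trans ij) 1?ltnW // !mulmxA.
exact: rank_tangent_mulr.
Qed.

Lemma term0_row theta j (D : 'M[R]_(d j.+1, d j)) h k i :
  D *m subprod theta j h = 0 -> (i <= h <= j)%N -> term theta D k i = 0.
Proof.
by move=> D0 ihj; rewrite /term -mulmxA (subprod_comp _ ihj) (mulmxA D) D0
  mul0mx mulmx0.
Qed.

Lemma term0_col theta j (D : 'M[R]_(d j.+1, d j)) l k i :
  subprod theta l j.+1 *m D = 0 -> (j < l <= k)%N -> term theta D k i = 0.
Proof.
by move=> D0 jlk; rewrite /term (subprod_comp _ jlk) -(mulmxA _ _ D) D0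
  mulmx0 mul0mx.
Qed.

Lemma delta_space_term theta j (D : 'M[R]_(d j.+1, d j)) : (j < L)%N ->
  delta_space theta j.+1 D ->
  term theta D L 0 = 0 /\
  forall k i, (i <= j < k)%N -> (k <= L)%N ->
    rank_tangent (subprod theta k i) (term theta D k i).
Proof.
move=> jL; pose P (D : 'M[R]_(d j.+1, d j)) := term theta D L 0 = 0 /\
  forall k i, (i <= j < k)%N -> (k <= L)%N ->
    rank_tangent (subprod theta k i) (term theta D k i).
have P0 : P 0.
  have t0 k i : @term theta j 0 k i = 0 by rewrite /term mulmx0 mul0mx.
  by split=> [|k i _ _]; rewrite t0 //; exact: rank_tangent0.
have PD x y : P x -> P y -> P (x + y).
  have tD k i : term theta (x + y) k i = term theta x k i + term theta y k i.
    by rewrite /term mulmxDr mulmxDl.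
  move=> [x0 xr] [y0 yr]; split=> [|k i ijk kL]; first by rewrite tD x0 y0 addr0.
  by rewrite tD; apply: rank_tangentD; [exact: xr|exact: yr].
suff: delta_space theta j.+1 `<=` P by exact.
move=> _ [_ [_ [a aP [b bP <-]] [c cP <-]] [e eP <-]].
suff [Pa Pb Pc Pe] : [/\ P a, P b, P c & P e].
  exact: (PD _ _ (PD _ _ (PD _ _ Pa Pb) Pc) Pe).
split.
(* If [h <= i], the column condition applies. Otherwise [i <= h.-1], and W_{j~i} factors through
   W_{j~h-1}, which [a] annihilates from the left. *)
- move: a aP; apply: sumset_min => // h; rewrite mem_index_iota.
  move=> /andP[h0 hj] a [/sub_colspaceP[K aK] /sub_nullspace_trP /= a0].
  split; first by apply: (term0_row _ a0); rewrite /= -ltnS prednK // ltnW.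
  move=> k i /andP[ij jk] kL; have [hi|ih] := leqP h i.
    by apply: (rank_tangent_term_col aK); rewrite ?hi.
  rewrite (term0_row _ a0); first exact: rank_tangent0.
  by rewrite -ltnS prednK // ih /= -ltnS prednK // ltnW.
(* Here the column condition holds with h = 0, hence for every [i]; the null space gives the
   vanishing for the full product. *)
- move: bP => [+ _]; rewrite sub_capmx => /andP[/sub_nullspaceP b0].
  move=> /sub_colspaceP[K bK]; split.
    by rewrite (term0_col _ b0) ?jL /=.
  by move=> k i /andP[ij jk] kL; apply: (rank_tangent_term_col bK); rewrite ?ij.
(* Dual to the first summand: the row condition for [k <= l], the null space for [k > l]. *)
- move: c cP; apply: sumset_min => // l; rewrite mem_index_iota.
  move=> /andP[jl lL] c [/sub_nullspaceP c0 /= /submxP[K cK]].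
  split; first by rewrite (term0_col _ c0) // ltnS (ltnW jl).
  move=> k i /andP[ij jk] kL; have [kl|lk] := leqP k l.
    by apply: (rank_tangent_term_row cK); rewrite ?jk.
  rewrite (term0_col _ c0); first exact: rank_tangent0.
  by rewrite ltnS (ltnW jl).
(* Dual to the second summand, with l = L. *)
- move: eP => [_]; rewrite sub_capmx => /andP[/submxP[K eK]].
  move=> /sub_nullspace_trP e0; split.
    by rewrite (term0_row _ e0) /=.
  move=> k i /andP[ij jk] kL.
  by apply: (rank_tangent_term_row eK); rewrite ?jk ?kL.
Qed.

Lemma delta_linearized_stratum theta :
  delta_gauge theta `<=` linearized_stratum theta.
Proof.
move=> Y [H [Delta [H0 HL DeltaP YE]]].
have YL k : (k < L)%N ->
    layers Y k = layers Delta k + - gauge theta H k.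
  move=> kL; rewrite /layers /gauge -[k]/(val (Ordinal kL)) !layerE YE.
  by rewrite opprB addrA.
have dY k i : (i <= k <= L)%N -> dsubprod theta (layers Y) k i =
    dsubprod theta (layers Delta) k i -
    (H k *m subprod theta k i - subprod theta k i *m H i).
  move=> /andP[ik kL]; rewrite -dsubprod_gauge // -dsubprodN -dsubprodD.
  by apply: eq_dsubprod => j /andP[_ jk]; rewrite YL // (leq_trans jk).
have DP j : (j < L)%N -> delta_space theta j.+1 (layers Delta j).
  by move=> jL; have := DeltaP (Ordinal jL); rewrite -layerE.
split=> [|k i ikL].
  rewrite dY ?leqnn // H0 HL mul0mx mulmx0 !subr0.
  rewrite /dsubprod big_nat big1 // => j /andP[_ jL].
  by have [] := delta_space_term jL (DP j jL).
rewrite dY //; have /andP[ik kL] := ikL; apply: rank_tangentD; last first.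
  apply/rank_tangentN; apply: rank_tangentD; first exact: rank_tangent_mulr.
  by apply: rank_tangentN; exact: rank_tangent_mull.
rewrite /dsubprod big_nat; apply: rank_tangent_sum => j /andP[ij jk].
have jL := leq_trans jk kL.
by have [_] := delta_space_term jL (DP j jL); apply; rewrite ?ij.
Qed.

End Tangent.

(** * Orthogonality *)

(** Take [A] of maximal rank with row space inside [N]: adjoining a vector of [N] cannot raise the
    rank. *)
Lemma subspace_rowspace (F : fieldType) n (N : set 'rV[F]_n) :
  N 0 -> (forall u v, N u -> N v -> N (u + v)) ->
  (forall a v, N v -> N (a *: v)) ->
  exists A : 'M[F]_n, forall v, N v <-> (v <= A)%MS.
Proof.
move=> N0 ND NZ.
pose P r := `[< exists A : 'M[F]_n,
  \rank A = r /\ forall v : 'rV[F]_n, (v <= A)%MS -> N v >].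
have P0 : exists r, P r.
  exists 0%N; apply/asboolP; exists 0; split; first by rewrite mxrank0.
  by move=> v; rewrite submx0 => /eqP->.
have Pn r : P r -> (r <= n)%N by move=> /asboolP[A [<- _]]; exact: rank_leq_row.
case: (ex_maxnP P0 Pn) => _ /asboolP[A [<- AN]] Amax.
exists A => v; split=> [Nv|]; last exact: AN.
have /Amax : P (\rank (A + v)%MS).
  apply/asboolP; exists (A + v)%MS; split=> // w /sub_addsmxP[[u1 u2] /= ->].
  apply: ND; first by apply: AN; exact: submxMl.
  by rewrite [u2]mx11_scalar mul_scalar_mx; exact: NZ.
rewrite (geq_leqif (mxrank_leqif_sup (addsmxSl A v))).
by apply: submx_trans; exact: addsmxSr.
Qed.

Lemma mxtrace_trmx_mul (F : fieldType) m n (A B : 'M[F]_(m, n)) :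
  \tr (A^T *m B) = \sum_i \sum_j A i j * B i j.
Proof.
rewrite exchange_big; apply: eq_bigr => j _.
by rewrite mxE; apply: eq_bigr => i _; rewrite mxE.
Qed.

(** * The Euclidean weight space and the claimed normal space *)

Section Weights.
Variables (R : realType) (L : nat) (d : nat -> nat).
Local Notation weights := (weights R L d).
Implicit Types (theta X Y Z : weights).

(** [weights] carries only an additive group structure, so scaling is given separately. *)
Definition wscale (a : R) X : weights := fun j => a *: X j.

Definition is_wsubspace (N : set weights) :=
  [/\ N 0, forall X Y, N X -> N Y -> N (X + Y) &
      forall a X, N X -> N (wscale a X)].

(** Listing all entries in one row vector turns [wdot] into a matrix product and brings subspaces of
    weights under matrix algebra. *)
Let entry := {j : 'I_L & ('I_(d j.+1) * 'I_(d j))%type}.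

Let vec X : 'rV[R]_#|{: entry}| :=
  \row_k X (tag (enum_val k)) (tagged (enum_val k)).1 (tagged (enum_val k)).2.

Let unvec (v : 'rV[R]_#|{: entry}|) : weights :=
  fun j => \matrix_(a, b)
    v 0 (enum_rank (Tagged (fun j : 'I_L => ('I_(d j.+1) * 'I_(d j))%type) (a, b))).

Let unvecK : cancel unvec vec.
Proof.
move=> v; apply/rowP => k; rewrite !mxE; congr (v 0 _).
by case E: (enum_val k) => [j [a b]] /=; rewrite -(enum_valK k) E.
Qed.

Let vecK : cancel vec unvec.
Proof.
move=> X; apply: functional_extensionality_dep => j.
by apply/matrixP => a b; rewrite !mxE enum_rankK.
Qed.

Let wdot_vec X Y : wdot X Y = (vec X *m (vec Y)^T) 0 0.
Proof.
rewrite mxE.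
rewrite (reindex_omap (@enum_rank _) (fun k => Some (enum_val k))) /=; last first.
  by move=> k _; rewrite enum_valK.
under [RHS]eq_bigr do rewrite !mxE enum_rankK.
under [RHS]eq_bigl do rewrite enum_rankK eqxx.
rewrite (eq_bigr (fun u : entry => X (tag u) (tagged u).1 (tagged u).2 *
  Y (tag u) (tagged u).1 (tagged u).2)) //.
rewrite -(sig_big_dep xpredT (fun=> xpredT)
  (fun (j : 'I_L) (u : 'I_(d j.+1) * 'I_(d j)) => X j u.1 u.2 * Y j u.1 u.2)) /=.
by apply: eq_bigr => j _; rewrite pair_big.
Qed.

Let unvecD u v : unvec (u + v) = unvec u + unvec v.
Proof.
apply: functional_extensionality_dep => j.
by apply/matrixP => a b; rewrite !mxE.
Qed.

Let unvecZ a v : unvec (a *: v) = wscale a (unvec v).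
Proof.
apply: functional_extensionality_dep => j.
by apply/matrixP => x y; rewrite !mxE.
Qed.

Let unvec0 : unvec 0 = 0.
Proof.
apply: functional_extensionality_dep => j.
by apply/matrixP => x y; rewrite !mxE.
Qed.

(** If the rows of [A] span [N], the columns of [cokermx A] are orthogonal to [N], hence to [X];
    this puts [X] in the row space of [A]. *)
Lemma wdot_biorthogonal (N : set weights) X : is_wsubspace N ->
  (forall Y, (forall Z, N Z -> wdot Z Y = 0) -> wdot X Y = 0) -> N X.
Proof.
move=> [N0 ND NZ] XP.
have [||a v|A AP] := @subspace_rowspace _ _ [set v | N (unvec v)].
- by rewrite /= unvec0.
- by move=> u v /= Nu Nv; rewrite unvecD; exact: ND.
- by move=> /= Nv; rewrite unvecZ; exact: NZ.
suff /AP : (vec X <= A)%MS by rewrite /= vecK.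
have dotE Z j : wdot Z (unvec (col j (cokermx A))^T) = (vec Z *m cokermx A) 0 j.
  by rewrite wdot_vec unvecK trmxK colE mulmxA -colE mxE.
rewrite submxE; apply/eqP/matrixP => i j; rewrite (ord1 i) -dotE [RHS]mxE.
apply: XP => Z NZ'; rewrite dotE.
have : (vec Z <= A)%MS by apply/AP; rewrite /= vecK.
by rewrite submxE => /eqP->; rewrite mxE.
Qed.

Lemma wsubspace_add (A B : set weights) :
  is_wsubspace A -> is_wsubspace B -> is_wsubspace (addset A B).
Proof.
move=> [A0 AD AZ] [B0 BD BZ]; split.
- by exists 0 => //; exists 0 => //; rewrite addr0.
- move=> _ _ [a Aa [b Bb <-]] [a' Aa' [b' Bb' <-]].
  exists (a + a'); first exact: AD.
  by exists (b + b'); [exact: BD|rewrite addrACA].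
- move=> c _ [a Aa [b Bb <-]]; exists (wscale c a); first exact: AZ.
  exists (wscale c b); first exact: BZ.
  by apply: functional_extensionality_dep => j; rewrite /wscale scalerDr.
Qed.

Lemma wsubspace_sumset (r : seq nat) (F : nat -> set weights) :
  (forall i, i \in r -> is_wsubspace (F i)) ->
  is_wsubspace (\big[@addset _/[set 0]]_(i <- r) F i).
Proof.
move=> FP; rewrite big_seq; elim/big_ind: _ => //; last exact: wsubspace_add.
split=> //= [X Y -> ->|a X ->]; first by rewrite addr0.
by apply: functional_extensionality_dep => j; rewrite /wscale scaler0.
Qed.

Lemma wsubspace_Xvec theta y x (N : set 'M[R]_(d y, d x)) : N 0 ->
  (forall A B, N A -> N B -> N (A + B)) -> (forall a A, N A -> N (a *: A)) ->
  is_wsubspace [set Xvec theta M | M in N].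
Proof.
move=> N0 ND NZ; split.
- exists 0 => //; apply: functional_extensionality_dep => j.
  by rewrite /Xvec /Xmx mulmx0 mul0mx if_same.
- move=> _ _ [A NA <-] [B NB <-]; exists (A + B); first exact: ND.
  apply: functional_extensionality_dep => j.
  change (Xvec theta (A + B) j = Xvec theta A j + Xvec theta B j).
  rewrite /Xvec /Xmx; case: ifP => _; last by rewrite addr0.
  by rewrite mulmxDr mulmxDl.
- move=> a _ [A NA <-]; exists (a *: A); first exact: NZ.
  apply: functional_extensionality_dep => j.
  rewrite /wscale /Xvec /Xmx; case: ifP => _; last by rewrite scaler0.
  by rewrite -scalemxAr -scalemxAl.
Qed.

Lemma wsubspace_Xvec_tensor theta y x u v (U : 'M[R]_(u, d y))
    (V : 'M[R]_(v, d x)) :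
  is_wsubspace [set Xvec theta M | M in tensor U V].
Proof.
apply: wsubspace_Xvec; first exact: tensor0.
- move=> A B [AU AV] [BU BV]; split; rewrite /rowspace ?addmx_sub //.
  by rewrite /colspace linearD addmx_sub.
- move=> a A [AU AV]; split; rewrite /rowspace ?scalemx_sub //.
  by rewrite /colspace linearZ scalemx_sub.
Qed.

(** By cyclicity of the trace, [Xvec theta] is the adjoint of the derivative of W_{y~x}. *)
Lemma wdot_Xvec theta y x (M : 'M[R]_(d y, d x)) Y : (y <= L)%N ->
  wdot (Xvec theta M) Y = \tr (M^T *m dsubprod theta (layers Y) y x).
Proof.
move=> yL; rewrite /wdot.
under eq_bigr do rewrite -mxtrace_trmx_mul.
pose f j := \tr ((Xmx theta M j.+1)^T *m layers Y j).
rewrite (eq_bigr (fun j : 'I_L => f j)); last first.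
  by move=> j _; rewrite /f /layers layerE.
rewrite -(big_mkord xpredT f) /dsubprod mulmx_sumr raddf_sum /=.
rewrite [RHS](big_nat_widenl _ 0%N) // [RHS](big_nat_widen _ _ L) //.
rewrite [RHS]big_mkcond /=.
apply: eq_bigr => j _; rewrite /f /Xmx ltnS.
case: (leqP x j) => _; case: (ltnP j y) => _ /=;
  try by rewrite trmx0 mul0mx mxtrace0.
rewrite !trmx_mul !trmxK -!mulmxA mxtrace_mulC -!mulmxA.
by [].
Qed.

Definition conormal theta : set weights :=
  addset
    [set Xvec theta M | M in [set: 'M[R]_(d L, d 0%N)]]
    (\sumset_(0 <= y < L.+1) \sumset_(0 <= x < y)
      [set Xvec theta M | M in
        tensor (nullspace (subprod theta y x)^T) (nullspace (subprod theta y x))]).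

Lemma wsubspace_conormal theta : is_wsubspace (conormal theta).
Proof.
apply: wsubspace_add; first exact: wsubspace_Xvec.
apply: wsubspace_sumset => y _; apply: wsubspace_sumset => x _.
exact: wsubspace_Xvec_tensor.
Qed.

Lemma wdotDl X Y Z : wdot (X + Y) Z = wdot X Z + wdot Y Z.
Proof.
rewrite /wdot -big_split; apply: eq_bigr => j _ /=.
rewrite -big_split; apply: eq_bigr => a _ /=.
by rewrite -big_split; apply: eq_bigr => b _ /=; rewrite mxE mulrDl.
Qed.

Lemma wdot0l Y : wdot 0 Y = 0.
Proof.
rewrite /wdot big1 // => j _; rewrite big1 // => a _; rewrite big1 // => b _.
by rewrite mxE mul0r.
Qed.

Lemma conormal_orthogonal theta X Y :
  conormal theta X -> linearized_stratum theta Y -> wdot X Y = 0.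
Proof.
move=> [_ [M _ <-] [Z ZP <-]] [Y0 YP].
rewrite wdotDl wdot_Xvec // Y0 mulmx0 mxtrace0 add0r.
have wdotD0 (U V : weights) : wdot U Y = 0 -> wdot V Y = 0 -> wdot (U + V) Y = 0.
  by move=> U0 V0; rewrite wdotDl U0 V0 addr0.
pose P : set weights := [set Z | wdot Z Y = 0].
suff : P Z by [].
move: Z ZP; apply: sumset_min => [|//|y]; first exact: wdot0l.
rewrite mem_index_iota ltnS => /andP[_ yL].
apply: sumset_min => [|//|x]; first exact: wdot0l.
rewrite mem_index_iota => /andP[_ xy] _ [N [NU NV] <-].
rewrite /P /= wdot_Xvec //; move: NU NV.
set A := subprod theta y x => /sub_kermxP; rewrite trmxK => NA.
move=> /sub_kermxP/(congr1 trmx); rewrite trmx_mul trmxK trmx0 => AN.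
have := YP y x; rewrite (ltnW xy) yL -/A => /(_ isT) AD.
(* With a generalized inverse [K] of [N^T], a cyclic permutation under the trace puts [N^T] on both
   sides of the derivative, where [rank_tangent] applies. *)
have [K NK] : exists K, N^T = N^T *m K *m N^T.
  by exists (pinvmx N^T); rewrite (@col_pinvmx _ _ _ _ _ _ 1%:M) ?mulmx1.
rewrite NK -!mulmxA mxtrace_mulC -!mulmxA (mulmxA N^T).
by rewrite (rank_tangent_mx AD) // mulmx0 mxtrace0.
Qed.

(** Elementary matrices as M^{L0} test each entry of D_{L~0}; the rank-one matrices [p^T *m q^T]
    test [p *m D *m q] for [p] and [q] in the two null spaces. *)
Lemma orthogonal_conormal theta Y :
  (forall Z, conormal theta Z -> wdot Z Y = 0) -> linearized_stratum theta Y.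
Proof.
move=> YP; have P0 y x i : i \in index_iota 0 y ->
    [set Xvec theta M | M in tensor (nullspace (subprod theta y i)^T)
      (nullspace (subprod theta y i))] 0.
  by move=> _; have [] := wsubspace_Xvec_tensor theta (nullspace (subprod theta y i)^T)
      (nullspace (subprod theta y i)).
have P1 i : i \in index_iota 0 L.+1 -> (\sumset_(0 <= x < i)
      [set Xvec theta M | M in tensor (nullspace (subprod theta i x)^T)
      (nullspace (subprod theta i x))]) 0.
  by move=> _; apply: sumset0 => x; exact: P0.
split.
  set D := dsubprod _ _ _ _; apply/matrixP => i j; rewrite [RHS]mxE.
  have : wdot (Xvec theta (delta_mx i j : 'M[R]_(d L, d 0%N))) Y = 0.
    apply: YP; exists (Xvec theta (delta_mx i j : 'M[R]_(d L, d 0%N))).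
      by exists (delta_mx i j).
    by exists 0; rewrite ?addr0 //; exact: sumset0.
  rewrite wdot_Xvec // mxtrace_trmx_mul (bigD1 i) //= (bigD1 j) //= mxE !eqxx mul1r.
  rewrite big1 => [|b bj]; last by rewrite mxE (negPf bj) andbF mul0r.
  rewrite addr0 big1 ?addr0 // => a ai; rewrite big1 // => b _.
  by rewrite mxE (negPf ai) mul0r.
move=> y x /andP[]; rewrite leq_eqVlt => /predU1P[->|xy] yL p q pA Aq.
  by rewrite dsubprod_id mulmx0 mul0mx.
have : wdot (Xvec theta (p^T *m q^T)) Y = 0.
  apply: YP; exists 0; first by have [] := @wsubspace_Xvec theta L 0%N setT.
  exists (Xvec theta (p^T *m q^T)); last by rewrite add0r.
  apply: (@sub_sumset _ (index_iota 0 L.+1) _ y) => //.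
    by rewrite mem_index_iota.
  apply: (@sub_sumset _ (index_iota 0 y) _ x) => //; first exact: P0.
    by rewrite mem_index_iota.
  exists (p^T *m q^T) => //; split.
    apply/sub_nullspace_trP.
    by rewrite /colspace trmx_mul !trmxK -mulmxA pA mulmx0.
  rewrite /rowspace; apply/sub_kermxP.
  by rewrite -mulmxA -trmx_mul Aq trmx0 mulmx0.
rewrite wdot_Xvec // trmx_mul !trmxK -(mulmxA q) mxtrace_mulC.
rewrite [X in \tr X]mx11_scalar mxtrace_scalar mulr1n => pDq.
by rewrite [LHS]mx11_scalar pDq raddf0.
Qed.

End Weights.

(** * Curves of matrices *)

Section MatrixDerivative.
Variable R : realType.

Lemma is_derive_bigsum (I : Type) (r : seq I) (P : pred I) (F : I -> R -> R)
    (D : I -> R) :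
  (forall i, P i -> is_derive (0 : R) 1 (F i) (D i)) ->
  is_derive (0 : R) 1 (fun t => \sum_(i <- r | P i) F i t)
    (\sum_(i <- r | P i) D i).
Proof.
move=> FD; elim: r => [|i r IHr].
  rewrite big_nil (_ : (fun _ => _) = cst 0); last first.
    by apply/funext => t; rewrite big_nil.
  exact: is_derive_cst.
rewrite big_cons; case: ifP => Pi; last first.
  by under eq_fun do rewrite big_cons Pi.
under eq_fun do rewrite big_cons Pi.
by apply: is_deriveD; first exact: FD.
Qed.

Lemma derivable_bigprod (I : Type) (r : seq I) (P : pred I) (F : I -> R -> R) :
  (forall i, P i -> derivable (F i) 0 1) ->
  derivable (fun t => \prod_(i <- r | P i) F i t) 0 1.
Proof.
move=> FD; elim: r => [|i r IHr].
  rewrite (_ : (fun _ => _) = cst 1); last first.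
    by apply/funext => t; rewrite big_nil.
  exact: derivable_cst.
case: (boolP (P i)) => Pi; last first.
  by under eq_fun do rewrite big_cons (negPf Pi).
under eq_fun do rewrite big_cons Pi.
by apply: derivableM; first exact: FD.
Qed.

Lemma is_derive_mul (f g : R -> R) (df dg : R) :
  is_derive (0 : R) 1 f df -> is_derive (0 : R) 1 g dg ->
  is_derive (0 : R) 1 (fun t => f t * g t) (df * g 0 + f 0 * dg).
Proof.
move=> fd gd; apply: is_derive_eq (is_deriveM fd gd) _.
by rewrite addrC; congr (_ + _); rewrite mulrC.
Qed.

Definition mx_derive m n (f : R -> 'M[R]_(m, n)) (D : 'M[R]_(m, n)) :=
  forall i j, is_derive (0 : R) 1 (fun t => f t i j) (D i j).

Lemma mx_derive_cst m n (A : 'M[R]_(m, n)) : mx_derive (fun=> A) 0.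
Proof. by move=> i j; rewrite mxE; exact: is_derive_cst. Qed.

Lemma mx_derive_mul m n p (f : R -> 'M[R]_(m, n)) (g : R -> 'M[R]_(n, p)) D E :
  mx_derive f D -> mx_derive g E ->
  mx_derive (fun t => f t *m g t) (D *m g 0 + f 0 *m E).
Proof.
move=> fD gE i j; under eq_fun do rewrite mxE.
rewrite !mxE -big_split /=; apply: is_derive_bigsum => k _.
exact: is_derive_mul.
Qed.

Lemma mx_derive_unique m n (f g : R -> 'M[R]_(m, n)) D E :
  (\forall t \near 0, f t = g t) -> mx_derive f D -> mx_derive g E -> D = E.
Proof.
move=> fg fD gE; apply/matrixP => i j.
have [_ <-] := fD i j; have [_ <-] := gE i j.
by apply: near_eq_derive; apply: filterS fg => t ->.
Qed.

(* Only the diagonal term of the Leibniz formula contributes: the others have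
   two factors vanishing at 0. *)
Lemma is_derive_det r (M : R -> 'M[R]_(r + 1)) (E : 'M[R]_(r + 1)) :
  M 0 = block_mx 1%:M 0 0 0 -> mx_derive M E ->
  is_derive (0 : R) 1 (fun t => \det (M t)) (drsubmx E 0 0).
Proof.
move=> M0 ME.
have Mder i j : derivable (fun t => M t i j) 0 1 by have [] := ME i j.
have Moff i j : i != j -> M 0 i j = 0.
  rewrite M0; case: (split_ordP i) => i' ->; case: (split_ordP j) => j' -> ij.
  - by rewrite block_mxEul mxE -(eq_lshift 1) (negPf ij).
  - by rewrite block_mxEur mxE.
  - by rewrite block_mxEdl mxE.
  - by rewrite block_mxEdr mxE.
(* The claimed derivative is spread over the permutations, all of it on the identity, to match the
   Leibniz formula term by term. *)
have -> : drsubmx E 0 0 = \sum_(s : 'S_(r + 1)) (s == 1%g)%:R * drsubmx E 0 0.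
  rewrite (bigD1 1%g) //= eqxx mul1r big1 ?addr0 // => s /negPf->.
  by rewrite mul0r.
rewrite /determinant; apply: is_derive_bigsum => s _.
suff prodP : is_derive (0 : R) 1 (fun t => \prod_i M t i (s i))
    ((s == 1%g)%:R * drsubmx E 0 0).
  have := is_derive_mul (is_derive_cst ((-1) ^+ s : R) (0 : R) (1 : R)) prodP.
  move/is_derive_eq; apply.
  rewrite mul0r add0r; case: eqVneq => [->|_]; last by rewrite !mul0r mulr0.
  by rewrite odd_perm1 expr0 !mul1r.
case: eqVneq => [->|s1]; last first.
  (* A nontrivial [s] moves some [i] and also [s i], which gives two distinct off-diagonal
     factors. *)
  have [i si] : exists i, s i != i.
    apply/existsP; apply: contra_neqT s1; rewrite negb_exists => /forallP s1.
    by apply/permP => i; rewrite perm1; apply/eqP; rewrite -[_ == _]negbK s1.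
  have ssi : s i != s (s i) by rewrite (inj_eq perm_inj) eq_sym.
  rewrite (_ : (fun _ => _) = fun t => M t i (s i) * (M t (s i) (s (s i)) *
      \prod_(k | (k != i) && (k != s i)) M t k (s k))); last first.
    by apply/funext => t; rewrite (bigD1 i) //= (bigD1 (s i)).
  have prodD : derivable
      (fun t => \prod_(k | (k != i) && (k != s i)) M t k (s k)) 0 1.
    exact: derivable_bigprod.
  have := is_derive_mul (ME i (s i)) (is_derive_mul (ME (s i) (s (s i)))
    (derivableP prodD)).
  by move/is_derive_eq; apply; rewrite !Moff // ?mul0r ?mulr0 ?addr0 // eq_sym.
pose f t := \prod_(k < r) M t (lshift 1 k) (lshift 1 k).
pose g t := M t (rshift r 0) (rshift r 0).
rewrite (_ : (fun _ => _) = fun t => f t * g t); last first.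
  apply/funext => t; rewrite big_split_ord /= big_ord1 perm1.
  by congr (_ * _); apply: eq_bigr => k _; rewrite perm1.
have fD : derivable f 0 1 by exact: derivable_bigprod.
have := is_derive_mul (derivableP fD) (ME (rshift r 0) (rshift r 0)).
move/is_derive_eq; apply.
rewrite M0 block_mxEdr mxE mulr0 add0r mul1r /f.
rewrite big1 ?mul1r; last by move=> k _; rewrite M0 block_mxEul mxE eqxx.
by rewrite /drsubmx !mxE.
Qed.

(** [U] and [V] are one-sided inverses of the two factors of a rank factorization of [A]. *)
Lemma full_rank_minor m n (A : 'M[R]_(m, n)) :
  exists (U : 'M[R]_(\rank A, m)) (V : 'M[R]_(n, \rank A)),
    U *m A *m V = 1%:M.
Proof.
have [U UA] := row_fullP (col_base_full A).
have [V AV] := row_freeP (row_base_free A).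
exists U, V; rewrite (_ : U *m A = U *m (col_base A *m row_base A)).
  by rewrite mulmxA UA mul1mx AV.
by rewrite mulmx_base.
Qed.

Lemma rank_tangent_derive m n (A : R -> 'M[R]_(m, n)) D :
  mx_derive A D -> (\forall t \near 0, \rank (A t) = \rank (A 0)) ->
  rank_tangent (A 0) D.
Proof.
move=> AD rkA p q pA Aq; set r := \rank (A 0) in rkA.
have [U [V UAV]] := full_rank_minor (A 0).
(* The minor P A(t) Q of size r + 1 vanishes near 0, and its derivative at 0 is
   p D q. *)
pose P := col_mx U p; pose Q := row_mx V q.
pose M t : 'M[R]_(r + 1) := P *m A t *m Q.
have M0 : M 0 = block_mx 1%:M 0 0 0.
  rewrite /M /P /Q mul_col_mx pA mul_mx_row mul_col_mx mul0mx.
  rewrite mul_col_mx mul0mx -[U *m _ *m q]mulmxA Aq mulmx0.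
  by rewrite UAV -block_mxEh.
have ME : mx_derive M (P *m D *m Q).
  have := mx_derive_mul (mx_derive_mul (mx_derive_cst P) AD) (mx_derive_cst Q).
  by rewrite mul0mx add0r mulmx0 addr0.
have [_ detM] := is_derive_det M0 ME.
(* [M t] has size r + 1 but factors through [A t], of rank r, so its determinant is 0 near 0. *)
have : 'D_1 (fun t => \det (M t)) (0 : R) = 'D_1 (cst 0) (0 : R).
  apply: near_eq_derive; apply: filterS rkA => t rkt.
  apply/eqP/negPn; rewrite -unitfE -unitmxE -row_free_unit.
  rewrite /row_free neq_ltn; apply/orP; left.
  have := leq_trans (mxrankM_maxl (P *m A t) Q) (mxrankM_maxr P (A t)).
  by rewrite rkt => rkM; rewrite (leq_ltn_trans rkM) // addn1.
rewrite detM derive_cst /P /Q mul_col_mx mul_mx_row !mul_col_mx => pDq.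
apply/matrixP => i j; rewrite !ord1 [RHS]mxE -[RHS]pDq.
by rewrite -block_mxEh block_mxKdr.
Qed.

End MatrixDerivative.

(** * Smoothness of rational functions *)

Section RationalFunctions.
Variables (R : realType) (e : R).

(** Closed under derivation on a fixed interval, so that one radius serves the derivatives of all
    orders. *)
Definition rational_on (f : R -> R) := exists p q : {poly R},
  forall t : R, `|t| < e -> q.[t] != 0 /\ f t = p.[t] / q.[t].

Lemma rational_onD f g : rational_on f -> rational_on g ->
  rational_on (fun t => f t + g t).
Proof.
move=> [p [q pq]] [p' [q' pq']]; exists (p * q' + p' * q), (q * q') => t te.
have [q0 ->] := pq t te; have [q'0 ->] := pq' t te.
by rewrite hornerD !hornerM mulf_neq0 // addf_div.
Qed.

Lemma rational_onM f g : rational_on f -> rational_on g ->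
  rational_on (fun t => f t * g t).
Proof.
move=> [p [q pq]] [p' [q' pq']]; exists (p * p'), (q * q') => t te.
have [q0 ->] := pq t te; have [q'0 ->] := pq' t te.
by rewrite !hornerM mulf_neq0 // mulf_div.
Qed.

Lemma rational_on_horner p : rational_on (horner p).
Proof. by exists p, 1 => t _; rewrite hornerE oner_neq0 divr1. Qed.

Lemma rational_on_cst a : rational_on (fun=> a).
Proof. by exists a%:P, 1 => t _; rewrite !hornerE oner_neq0 divr1. Qed.

Lemma rational_on_sum n (F : 'I_n -> R -> R) :
  (forall i, rational_on (F i)) -> rational_on (fun t => \sum_i F i t).
Proof.
move=> FP; elim: (index_enum _) => [|i r IHr].
  by under eq_fun do rewrite big_nil; exact: rational_on_cst.
by under eq_fun do rewrite big_cons; exact: rational_onD.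
Qed.

Lemma rational_on_derive f : rational_on f ->
  (forall t : R, `|t| < e -> derivable f t 1) /\ rational_on (f^`())%classic.
Proof.
move=> [p [q pq]].
have nearE (t : R) : `|t| < e -> \forall s \near t, p.[s] / q.[s] = f s.
  move=> te; have : \forall s \near t, `|s| < e.
    have := @norm_continuous _ _ t.
    by move=> /cvgr_lt; apply.
  by apply: filterS => s /pq[].
have fD (t : R) : `|t| < e -> is_derive t (1 : R) f
    ((p^`() * q - p * q^`()).[t] / (q ^+ 2).[t]).
  move=> te; have [q0 _] := pq t te.
  apply: near_eq_is_derive (nearE t te) _.
  have pD := @is_derive_poly _ p t; have qD := @is_derive_poly _ q t.
  have qVD : is_derive t (1 : R) (fun s => (q.[s])^-1) (- q.[t] ^- 2 *: q^`().[t]).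
    apply: DeriveDef; first by apply: derivableV => //; case: qD.
    by rewrite (deriveV q0) //; case: qD => // _ ->.
  have := is_deriveM pD qVD; move/is_derive_eq; apply.
  rewrite !hornerE /= /GRing.scale /=.
  field.
  exact: q0.
split=> [t /fD[]//|]; exists (p^`() * q - p * q^`()), (q ^+ 2) => t te.
have [q0 _] := pq t te; split; first by rewrite horner_exp expf_neq0.
by rewrite derive1E; have [_ ->] := fD t te.
Qed.

Lemma rational_on_smooth f : 0 < e -> rational_on f -> smooth_near0 f.
Proof.
move=> e0 fP; exists e => // n.
have : rational_on (f^`(n))%classic.
  elim: n => // n IHn; rewrite derive1nS.
  by have [] := rational_on_derive IHn.
by move=> /rational_on_derive[].
Qed.

End RationalFunctions.

(** * Velocities of curves in a stratum *)

Section Curves.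
Variables (R : realType) (L : nat) (d : nat -> nat).
Local Notation weights := (weights R L d).
Implicit Types (theta X Y : weights) (S : set weights).

Lemma subprod_derive (c : R -> weights) Y k i : (i <= k <= L)%N ->
  (forall j a b, is_derive (0 : R) 1 (fun t => c t j a b) (Y j a b)) ->
  mx_derive (fun t => subprod (c t) k i) (dsubprod (c 0) (layers Y) k i).
Proof.
move=> ikL cY; elim: k ikL => [|k IHk] /andP[ik kL].
  move: ik; rewrite leqn0 => /eqP->; rewrite dsubprod_id; exact: mx_derive_cst.
move: ik; rewrite leq_eqVlt ltnS => /predU1P[->|ik].
  rewrite dsubprod_id; under eq_fun do rewrite subprod_id.
  exact: mx_derive_cst.
under eq_fun do rewrite subprodS //.
rewrite dsubprodS //.
apply: (@mx_derive_mul _ _ _ _ (fun t => layer (c t) k.+1)); last first.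
  by apply: IHk; rewrite ik ltnW.
move=> a b; rewrite /layers -[k.+1]/(val (Ordinal kL)).+1 layerE.
by under eq_fun do rewrite layerE; exact: cY.
Qed.

(** T is included in B: along the curve the full product is constant and every W_{k~i} has constant
    rank. *)
Lemma tangent_linearized W S theta : is_stratum W S -> S theta ->
  tangent_subspace S theta `<=` linearized_stratum theta.
Proof.
move=> [_ [r SE]] Stheta Y [c [c0 Sc _ cY]].
have [muW rk] : mu theta = W /\ forall k i, (i <= k <= L)%N ->
    \rank (subprod theta k i) = r k i by move: Stheta; rewrite SE.
rewrite -c0 in muW rk *; split=> [|k i ikL].
  apply: (@mx_derive_unique _ _ _ (fun t => subprod (c t) L 0) (fun=> W)).
  - by apply: filterS Sc => t; rewrite SE => -[].
  - by apply: subprod_derive; rewrite ?leqnn.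
  - exact: mx_derive_cst.
apply: (@rank_tangent_derive _ _ _ (fun t => subprod (c t) k i)).
  exact: subprod_derive.
by apply: filterS Sc => t; rewrite SE => -[_ rkt]; rewrite rkt // rk.
Qed.

Lemma gauge_tangent W S theta Y G : is_stratum W S -> S theta ->
  G L *m subprod theta L 0 = subprod theta L 0 *m G 0%N ->
  (forall j : 'I_L, Y j = gauge theta G j) -> tangent_subspace S theta Y.
Proof.
move=> [_ [r SE]] Stheta GW YG.
have [muW rk] : mu theta = W /\ forall k i, (i <= k <= L)%N ->
    \rank (subprod theta k i) = r k i by move: Stheta; rewrite SE.
pose P k t : 'M[R]_(d k) := 1%:M + t *: G k.
(* [P k] with the time as a polynomial variable: the adjugate and determinant of [PX k] exhibit the
   entries of the inverse as rational functions. *)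
pose PX k : 'M[{poly R}]_(d k) := 1%:M + 'X *: map_mx polyC (G k).
have PXE k t : map_mx (horner_eval t) (PX k) = P k t.
  apply/matrixP => a b; rewrite !mxE /horner_eval /= !hornerE.
  by case: eqP => _; rewrite ?hornerE.
have detE k t : (\det (PX k)).[t] = \det (P k t).
  by rewrite -PXE det_map_mx.
(* As [q] is 1 at 0, a single radius [e] makes all the [P k t] invertible. *)
pose q := \prod_(k < L.+1) \det (PX k).
have [e e0 qe] : exists2 e : R, 0 < e & forall t, `|t| < e -> q.[t] != 0.
  have : \forall t \near 0, q.[t] != 0.
    have q0 : q.[0] != 0.
      rewrite horner_prod prodf_seq_neq0; apply/allP => k _ /=.
      by rewrite detE /P scale0r addr0 det1 oner_neq0.
    exact: (cvgr_neq0 _ (@continuous_horner _ q 0) q0).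
  move=> /nbhs_ballP[e /= e0 qe]; exists e => // t te; apply: qe.
  by rewrite /ball /= sub0r normrN.
have Punit k t : (k <= L)%N -> `|t| < e -> P k t \in unitmx.
  move=> kL te; rewrite unitmxE unitfE -detE.
  have := qe t te; rewrite horner_prod prodf_seq_neq0 => /allP.
  by move=> /(_ (Ordinal (kL : (k < L.+1)%N)) (mem_index_enum _)).
pose c t : weights := fun j => P j.+1 t *m theta j *m invmx (P j t).
have P0 k : P k 0 = 1%:M by rewrite /P scale0r addr0.
have c0 : c 0 = theta.
  apply: functional_extensionality_dep => j.
  by rewrite /c !P0 invmx1 mulmx1 mul1mx.
(* The inner factors cancel, so each partial product is multiplied by invertible matrices only and
   keeps its rank. *)
have subc t k i : `|t| < e -> (i <= k <= L)%N ->
    subprod (c t) k i = P k t *m subprod theta k i *m invmx (P i t).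
  move=> te; elim: k => [|k IHk] /andP[ik kL].
    move: ik; rewrite leqn0 => /eqP->.
    by rewrite !subprod_id mulmx1 mulmxV // Punit.
  move: ik; rewrite leq_eqVlt ltnS => /predU1P[->|ik].
    by rewrite !subprod_id mulmx1 mulmxV // Punit.
  rewrite !subprodS // IHk ?ik 1?ltnW //.
  rewrite -[k.+1]/(val (Ordinal kL)).+1 !layerE /c /= !mulmxA.
  by rewrite mulmxKV // Punit // ltnW.
have near_e : \forall t \near (0 : R), `|t| < e.
  by apply/nbhs_ballP; exists e => // t; rewrite /ball /= sub0r normrN.
have crat j a b : rational_on e (fun t => c t j a b).
  have Prat k x y : rational_on e (fun t => P k t x y).
    under eq_fun do rewrite -PXE mxE.
    exact: rational_on_horner.
  have Pinv x y : rational_on e (fun t => invmx (P j t) x y).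
    exists (\adj (PX j) x y), (\det (PX j)) => t te.
    have Pu : P j t \in unitmx by rewrite Punit // ltnW.
    split; first by rewrite detE -unitfE -unitmxE.
    rewrite /invmx Pu mxE detE mulrC -PXE -map_mx_adj mxE //.
  rewrite /c; under eq_fun do rewrite mxE.
  apply: rational_on_sum => x; apply: rational_onM => //.
  under eq_fun do rewrite mxE.
  apply: rational_on_sum => z; apply: rational_onM => //.
  exact: rational_on_cst.
have csm j a b := rational_on_smooth e0 (crat j a b).
exists c; split=> //.
  apply: filterS near_e => t te; rewrite SE; split.
    rewrite /mu subc ?leqnn // /P mulmxDl mul1mx -scalemxAl GW.
    rewrite scalemxAr -{1}[subprod _ _ _]mulmx1 -mulmxDr mulmxK //.
    exact: Punit.
  move=> k i ikL; have /andP[ik kL] := ikL; rewrite -rk // subc //.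
  rewrite mxrankMfree ?row_free_unit ?unitmx_inv ?Punit // ?(leq_trans ik) //.
  by rewrite (eqmxMfull _ _) // row_full_unit Punit.
move=> j.
(* The velocity [C] is found without differentiating an inverse: differentiating
   [c t j *m P j t = P j.+1 t *m theta j] at 0 gives C + W_{j+1} G_j = G_{j+1} W_{j+1}. *)
pose C : 'M[R]_(d j.+1, d j) := \matrix_(a, b) 'D_1 (fun t => c t j a b) (0 : R).
have cC : mx_derive (fun t => c t j) C.
  move=> a b; rewrite mxE; apply: derivableP.
  have [e' e'0 /(_ 0%N 0)] := csm j a b; apply.
  by rewrite normr0.
have PD k : mx_derive (P k) (G k).
  move=> a b.
  pose p1 := ((1%:M : 'M[R]_(d k)) a b)%:P; pose pX := (G k a b)%:P * 'X.
  rewrite (_ : (fun _ => _) = horner p1 + horner pX).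
    have := is_deriveD (@is_derive_poly _ p1 0) (@is_derive_poly _ pX 0).
    move/is_derive_eq; apply.
    by rewrite /p1 /pX derivM !derivC derivX mul0r !add0r mulr1 horner0 add0r hornerC.
  by apply/funext => t; rewrite /p1 /pX !fctE !mxE !hornerE mulrC.
suff -> : Y j = C by [].
have := mx_derive_unique _ (mx_derive_mul cC (PD j))
  (mx_derive_mul (PD j.+1) (mx_derive_cst (theta j))).
rewrite !P0 c0 mulmx1 mulmx0 addr0 => CE.
rewrite YG /gauge layerE -CE ?addrK //.
apply: filterS near_e => t te; rewrite /c mulmxKV // Punit // ltnW //.
Qed.

End Curves.

(** * Tangent and normal spaces of a stratum *)

Theorem mainTheorem8 (R : realType) (L : nat) (d : nat -> nat)
    (L_ge1 : (1 <= L)%N) (d_ge1 : forall k : nat, (k <= L)%N -> (1 <= d k)%N)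
    (W : 'M[R]_(d L, d 0%N)) (S : set (weights R L d)) (S_stratum : is_stratum W S)
    (theta : weights R L d) (theta_S : S theta) :
  tangent_subspace S theta =
    [set Y : weights R L d |
      exists (H : forall k : nat, 'M[R]_(d k)) (Delta : weights R L d),
      [/\ H 0%N = 0, H L = 0,
          forall j : 'I_L, delta_space theta j.+1 (Delta j) &
          forall j : 'I_L, Y j = Delta j + theta j *m H j - H j.+1 *m theta j]]
  /\
  normal_subspace S theta =
    addset
      [set Xvec theta M | M in [set: 'M[R]_(d L, d 0%N)]]
      (\sumset_(0 <= y < L.+1) \sumset_(0 <= x < y)
        [set Xvec theta M | M in
          tensor (nullspace (subprod theta y x)^T) (nullspace (subprod theta y x))]).
Proof.
(* T is included in B, and B in A, which is included in T. *)
have TE : tangent_subspace S theta = linearized_stratum theta.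
  apply/seteqP; split; first exact: tangent_linearized S_stratum theta_S.
  move=> Y /linearized_stratum_gauge[G [GW YG]].
  exact: gauge_tangent S_stratum theta_S GW YG.
split.
  rewrite TE; apply/seteqP; split; last exact: delta_linearized_stratum.
  by move=> Y /linearized_stratum_gauge[G [GW YG]]; exact: gauge_delta GW YG.
apply/seteqP; split=> X.
  (* The claimed normal space equals its double orthogonal; its orthogonal lies in B = T, to which
     [X] is orthogonal. *)
  move=> XN; apply: (wdot_biorthogonal (wsubspace_conormal theta)) => Y YN.
  by apply: XN; rewrite TE; exact: orthogonal_conormal.
move=> XN Y; rewrite TE => YT; exact: conormal_orthogonal XN YT.
Qed.
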